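(* Let $G$ be a $\{K_3, K_{2,3}, P_2 \,\Box\, P_3\}$-free graph. Then $\gamma(H) = \gamma_e(H)$ for every induced subgraph $H$ of $G$ if and only if $G$ is $\{P_7, C_7, F_1, F_2, F_3, F_4, F_5\}$-free.
   Context: All graphs are finite, simple, and undirected. For a set $\mathcal{F}$ of graphs, a graph $G$ is $\mathcal{F}$-free if no induced subgraph of $G$ is isomorphic to a member of $\mathcal{F}$. Domination. A set $D$ of vertices of a graph $G$ is a dominating set of $G$ if every vertex of $G$ not in $D$ has a neighbor in $D$. The domination number $\gamma(G)$ is the minimum order of a dominating set of $G$. Exponential domination. Let $D$ be a set of vertices of a graph $G$. For two (not necessarily distinct) vertices $u,v$ of $G$, let $\mathrm{dist}_{(G,D)}(u,v)$ be the minimum length (number of edges) of a path $P$ in $G$ between $u$ and $v$ such that $D$ contains exactly one endvertex of $P$ but no internal vertex of $P$; if no such path exists, $\mathrm{dist}_{(G,D)}(u,v)=\infty$. In particular, if $u$ and $v$ are distinct vertices in $D$, then $\mathrm{dist}_{(G,D)}(u,u)=0$ and $\mathrm{dist}_{(G,D)}(u,v)=\infty$. For a vertex $u$ of $G$ let $$w_{(G,D)}(u)=\sum_{v\in D}\left(\tfrac12\right)^{\mathrm{dist}_{(G,D)}(u,v)-1},$$ where $\left(\tfrac12\right)^{\infty}=0$ (so $w_{(G,D)}(u)=2$ for $u\in D$). The set $D$ is an exponential dominating set of $G$ if $w_{(G,D)}(u)\ge 1$ for every vertex $u$ of $G$. The exponential domination number $\gamma_e(G)$ is the minimum order of an exponential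 dominating set of $G$. Specific graphs. $P_n$ and $C_n$ are the path and the cycle of order $n$; $K_3$ is the triangle; $K_{2,3}$ is the complete bipartite graph with parts of sizes 2 and 3; $\Box$ denotes the Cartesian product, so $P_2 \,\Box\, P_3$ is the $2\times 3$ grid. - $F_1$: vertices $a,b,c,a',b',c'$, edges $ab, bc, aa', bb', cc'$ (a path on three vertices with one pendant vertex attached to each of its vertices). - $F_2$: vertices $a,b,c,d,p,q,r$, edges $ab, bc, cd, da, ap, pq, qr$ (a 4-cycle with a pendant path of three edges attached at one of its vertices). - $F_3$: vertices $a,b,c,d,p,q,r$, edges $ab, bc, cd, da, ap, pq, qr, rb$ (a 4-cycle and a 5-cycle sharing exactly the edge $ab$ and its endpoints). - $F_4$: vertices $a,b,c,d,p,q,r$, edges $ab, bc, cd, da, ap, pq, qr, ra$ (two 4-cycles sharing exactly one vertex $a$). - $F_5$: vertices $a,b,c,d,e,f,g$, edges $ab, bc, cd, da, be, ef, fd, cg$ (a 4-cycle $abcd$, a path $b\,e\,f\,d$ of three edges joining the opposite vertices $b$ and $d$ through two new vertices $e,f$, and a pendant vertex $g$ attached to $c$). *)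

(* Defs.v *)
From Stdlib Require List.
From mathcomp Require Import all_boot all_order all_algebra.

Set Implicit Arguments.
Unset Strict Implicit.
Unset Printing Implicit Defensive.

Import Order.TTheory GRing.Theory Num.Theory.

Record sgraph := SGraph {
  vertex :> finType;
  edge : rel vertex;
  edge_sym : symmetric edge;
  edge_irrefl : irreflexive edge
}.

Arguments edge {s} x y.

Definition isomorphic (G H : sgraph) : Prop :=
  exists f : G -> H,
    bijective f /\ forall x y : G, edge (f x) (f y) = edge x y.

Section Induced.
Variables (G : sgraph) (S : {set G}).

Definition induced_edge : rel {x : G | x \in S} :=
  fun x y => edge (val x) (val y).

Lemma induced_edge_sym : symmetric induced_edge.
Proof. by move=> x y; apply: edge_sym. Qed.

Lemma induced_edge_irrefl : irreflexive induced_edge.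
Proof. by move=> x; apply: edge_irrefl. Qed.

Definition induced : sgraph := SGraph induced_edge_sym induced_edge_irrefl.
End Induced.

Definition free (Fs : seq sgraph) (G : sgraph) : Prop :=
  forall F : sgraph, List.In F Fs ->
  forall S : {set G}, ~ isomorphic (induced S) F.

Section Domination.
Variable G : sgraph.
Implicit Types (D : {set G}) (u v : G).

Definition dominating D : bool :=
  [forall x : G, (x \notin D) ==> [exists y in D, edge x y]].

Lemma dominating_setT : dominating setT.
Proof. by apply/forallP => x; rewrite in_setT. Qed.

(* [setT] is only a default value; it is dominating (dominating_setT), so
   this is a minimum over a nonempty family, as gammaP records. *)
Definition gamma : nat := #|[arg min_(D < setT | dominating D) #|D|]|.

Lemma gammaP :
  (exists2 D, dominating D & #|D| = gamma) /\
  (forall D, dominating D -> gamma <= #|D|).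
Proof.
by rewrite /gamma; case: arg_minnP => [|D dD minD]; [exact: dominating_setT |
  split=> //; exists D].
Qed.

(* [u :: p] is a (simple) path from u to v whose internal vertices are those
   of [behead (belast u p)]. A path of length 0 has a single endvertex u = v;
   hence "exactly one endvertex in D" is about the set {u, v}. *)
Definition admissible_path D u v (p : seq G) : bool :=
  [&& path edge u p, last u p == v, uniq (u :: p),
      #|[set u; v] :&: D| == 1 &
      all (fun x => x \notin D) (behead (belast u p))].

Definition linked D u v (k : nat) : bool :=
  [exists p : k.-tuple G, admissible_path D u v p].

(* [None] is infinity. The least k is found by searching k < #|G|, which
   suffices since a simple path has fewer than #|G| edges. *)
Definition dist D u v : option nat :=
  ohead [seq k <- iota 0 #|G| | linked D u v k].

Lemma admissible_path_linked D u v (p : seq G) :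
  admissible_path D u v p -> linked D u v (size p).
Proof. by move=> pP; apply/existsP; exists (in_tuple p). Qed.

Lemma linkedP D u v k :
  reflect (exists2 p : seq G, admissible_path D u v p & size p = k)
          (linked D u v k).
Proof.
apply: (iffP idP) => [/existsP[p pP]|[p pP <-]].
  by exists p; rewrite ?size_tuple.
exact: admissible_path_linked.
Qed.

Lemma linked_lt D u v k : linked D u v k -> k < #|G|.
Proof.
case/linkedP => p /and5P[_ _ up _ _] <-.
by rewrite -[(size p).+1]/(size (u :: p)) -(card_uniqP up) max_card.
Qed.

Lemma distP D u v :
  if dist D u v is Some k then
    linked D u v k /\ (forall p, admissible_path D u v p -> k <= size p)
  else forall p, ~~ admissible_path D u v p.
Proof.
have srt : sorted ltn [seq k <- iota 0 #|G| | linked D u v k].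
  exact: (sorted_filter ltn_trans _ (iota_ltn_sorted 0 #|G|)).
have inF p : admissible_path D u v p ->
    size p \in [seq k <- iota 0 #|G| | linked D u v k].
  move/admissible_path_linked => lk.
  by rewrite mem_filter lk mem_iota /= add0n (linked_lt lk).
rewrite /dist; case E: [seq k <- _ | _] => [|k s] /=.
  by move=> p; apply/negP => /inF; rewrite E.
have: k \in [seq k <- iota 0 #|G| | linked D u v k] by rewrite E mem_head.
rewrite mem_filter => /andP[lk _]; split=> // p /inF.
rewrite E inE => /predU1P[->//|ps].
move: srt; rewrite E /= (path_sortedE ltn_trans) => /andP[/allP/(_ _ ps)].
by move/ltnW.
Qed.

Local Open Scope ring_scope.

(* The exponent k - 1 is an integer: k = 0 contributes 2. *)
Definition half_pow (d : option nat) : rat :=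
  if d is Some k then 2^-1 ^ (k%:Z - 1) else 0.

Definition weight D u : rat := \sum_(v in D) half_pow (dist D u v).

Definition exp_dominating D : bool := [forall u : G, 1 <= weight D u].

Local Close Scope ring_scope.

Lemma dist_self D u : u \in D -> dist D u u = Some 0.
Proof.
move=> uD; have h : admissible_path D u u [::].
  by rewrite /admissible_path /= eqxx setUid (setIidPl _) ?sub1set // cards1.
move: (distP D u u); case: dist => [k [_ /(_ _ h)]|/(_ [::])].
  by rewrite leqn0 => /eqP ->.
by rewrite h.
Qed.

Lemma dist_two D u v : u \in D -> v \in D -> u != v -> dist D u v = None.
Proof.
move=> uD vD uv; move: (distP D u v); case: dist => // k [/linkedP[p]].
case/and5P => _ _ _ + _ _.
by rewrite (setIidPl _) ?subUset ?sub1set ?uD // cards2 uv.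
Qed.

Lemma weight_in D u : u \in D -> weight D u = 2%:R%R.
Proof.
move=> uD; rewrite /weight (bigD1 u) //= dist_self // big1 ?addr0 //.
by move=> v /andP[vD vu]; rewrite dist_two // eq_sym.
Qed.

Lemma exp_dominating_setT : exp_dominating setT.
Proof. by apply/forallP => u; rewrite weight_in. Qed.

(* As for [gamma], the default value [setT] is itself admissible. *)
Definition gamma_e : nat := #|[arg min_(D < setT | exp_dominating D) #|D|]|.

Lemma gamma_eP :
  (exists2 D, exp_dominating D & #|D| = gamma_e) /\
  (forall D, exp_dominating D -> gamma_e <= #|D|).
Proof.
by rewrite /gamma_e; case: arg_minnP => [|D dD minD];
  [exact: exp_dominating_setT | split=> //; exists D].
Qed.

End Domination.

Section EdgeList.
Variables (n : nat) (E : seq (nat * nat)).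

Definition edge_list_rel : rel 'I_n :=
  fun i j => (i != j) &&
    (((val i, val j) \in E) || ((val j, val i) \in E)).

Lemma edge_list_sym : symmetric edge_list_rel.
Proof. by move=> i j; rewrite /edge_list_rel eq_sym orbC. Qed.

Lemma edge_list_irrefl : irreflexive edge_list_rel.
Proof. by move=> i; rewrite /edge_list_rel eqxx. Qed.

Definition edge_list_graph : sgraph := SGraph edge_list_sym edge_list_irrefl.
End EdgeList.

Section Families.
Variable n : nat.

Definition path_rel : rel 'I_n := fun i j => (i.+1 == j) || (j.+1 == i).

Lemma path_rel_sym : symmetric path_rel.
Proof. by move=> i j; rewrite /path_rel orbC. Qed.

Lemma path_rel_irrefl : irreflexive path_rel.
Proof. by move=> i; rewrite /path_rel orbb gtn_eqF. Qed.

Definition path_graph : sgraph := SGraph path_rel_sym path_rel_irrefl.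

(* The condition i != j only matters for n = 1; this is the cycle of order n
   when n >= 3. *)
Definition cycle_rel : rel 'I_n :=
  fun i j => (i != j) && ((i.+1 %% n == j) || (j.+1 %% n == i)).

Lemma cycle_rel_sym : symmetric cycle_rel.
Proof. by move=> i j; rewrite /cycle_rel eq_sym orbC. Qed.

Lemma cycle_rel_irrefl : irreflexive cycle_rel.
Proof. by move=> i; rewrite /cycle_rel eqxx. Qed.

Definition cycle_graph : sgraph := SGraph cycle_rel_sym cycle_rel_irrefl.

Definition complete_rel : rel 'I_n := fun i j => i != j.

Lemma complete_rel_sym : symmetric complete_rel.
Proof. by move=> i j; rewrite /complete_rel eq_sym. Qed.

Lemma complete_rel_irrefl : irreflexive complete_rel.
Proof. by move=> i; rewrite /complete_rel eqxx. Qed.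

Definition complete_graph : sgraph :=
  SGraph complete_rel_sym complete_rel_irrefl.
End Families.

Section CompleteBipartite.
Variables m n : nat.

Definition bipartite_rel : rel ('I_m + 'I_n)%type :=
  fun x y => match x, y with
             | inl _, inr _ | inr _, inl _ => true
             | _, _ => false
             end.

Lemma bipartite_rel_sym : symmetric bipartite_rel.
Proof. by case=> i [] j. Qed.

Lemma bipartite_rel_irrefl : irreflexive bipartite_rel.
Proof. by case. Qed.

Definition complete_bipartite : sgraph :=
  SGraph bipartite_rel_sym bipartite_rel_irrefl.
End CompleteBipartite.

Section Cartesian.
Variables G H : sgraph.

Definition cartesian_rel : rel (G * H)%type :=
  fun x y => ((x.1 == y.1) && edge x.2 y.2) ||
             (edge x.1 y.1 && (x.2 == y.2)).

Lemma cartesian_rel_sym : symmetric cartesian_rel.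
Proof.
move=> x y; rewrite /cartesian_rel (eq_sym x.1) (eq_sym x.2).
by rewrite (edge_sym x.1) (edge_sym x.2).
Qed.

Lemma cartesian_rel_irrefl : irreflexive cartesian_rel.
Proof. by move=> x; rewrite /cartesian_rel !edge_irrefl andbF. Qed.

Definition cartesian : sgraph :=
  SGraph cartesian_rel_sym cartesian_rel_irrefl.
End Cartesian.

(* A path on three vertices with a pendant vertex attached to each. *)
Definition F1 : sgraph :=
  let '(a, b, c, a', b', c') := (0, 1, 2, 3, 4, 5) in
  edge_list_graph 6 [:: (a, b); (b, c); (a, a'); (b, b'); (c, c')].

(* A 4-cycle with a pendant path of three edges. *)
Definition F2 : sgraph :=
  let '(a, b, c, d, p, q, r) := (0, 1, 2, 3, 4, 5, 6) in
  edge_list_graph 7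
    [:: (a, b); (b, c); (c, d); (d, a); (a, p); (p, q); (q, r)].

(* A 4-cycle and a 5-cycle sharing exactly the edge ab. *)
Definition F3 : sgraph :=
  let '(a, b, c, d, p, q, r) := (0, 1, 2, 3, 4, 5, 6) in
  edge_list_graph 7
    [:: (a, b); (b, c); (c, d); (d, a); (a, p); (p, q); (q, r); (r, b)].

(* Two 4-cycles sharing exactly the vertex a. *)
Definition F4 : sgraph :=
  let '(a, b, c, d, p, q, r) := (0, 1, 2, 3, 4, 5, 6) in
  edge_list_graph 7
    [:: (a, b); (b, c); (c, d); (d, a); (a, p); (p, q); (q, r); (r, a)].

(* A 4-cycle abcd, a path b e f d of three edges joining its opposite
   vertices b and d, and a vertex g pendant at c. *)
Definition F5 : sgraph :=
  let '(a, b, c, d, e, f, g) := (0, 1, 2, 3, 4, 5, 6) in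
  edge_list_graph 7
    [:: (a, b); (b, c); (c, d); (d, a); (b, e); (e, f); (f, d); (c, g)].

(* Main.v *)
Require Import Defs.
From mathcomp Require Import all_boot.
From Stdlib Require List.
From mathcomp Require Import order ssralg ssrnum ssrint rat.

Set Implicit Arguments.
Unset Strict Implicit.
Unset Printing Implicit Defensive.

(** The seven graphs P_7, C_7, F_1, ..., F_5 are small counterexamples: each
of them has two vertices that exponentially dominate it, but no two vertices
that dominate it ([critical_pairs]).  So an induced copy of one of them is an
induced subgraph on which the two parameters differ.

For the converse, a dominating set is always exponentially dominating, and the
point is that forbidding all ten graphs forces small domination numbers: every
connected set of vertices is dominated by at most two vertices
([component_dominating_pair]).  Given an exponentially dominating set D, the
weights only see D component by component.  If D has a single vertex in some
component, weight at least 1 forces every vertex of the component to be within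
distance 1 of it; if D has at least two vertices there, two of them may be
exchanged for a dominating pair of the component.  The result is a dominating
set that is no larger than D ([exp_dominating_replace]).

The existence of dominating pairs is proved by growing a connected set one
vertex at a time.  Suppose that T is connected and dominated by x and y, that v
is attached to T, and that no two vertices dominate T + v.  Then v is adjacent
to neither x nor y, but has a neighbour w adjacent to one of them, say x;
connectedness of T puts x and y at distance at most 3; and every other vertex
of T is adjacent to x or to y.  Now name x, y, v, w and the vertices of a short
path from x to y.  Whenever two named vertices dominate all the named ones,
some vertex of T + v is dominated by neither, so it is new, it is adjacent to x
or y, and it has one of finitely many sets of named neighbours.  Most choices
create one of the ten forbidden graphs at once, and naming at most four
such vertices always ends in a forbidden graph.  This finite case analysis is
carried out by evaluating a search ([refute_all_true]) whose soundness is
[refuteP]; [no_minimal_counterexample] connects it with the situation above. *)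

(** * Drawing concrete graphs inside a graph *)

Definition adj (E : seq (nat * nat)) : rel nat :=
  fun i j => ((i, j) \in E) || ((j, i) \in E).

Lemma adjC E i j : adj E i j = adj E j i.
Proof. by rewrite /adj orbC. Qed.

(** The first [n] values of [f] are distinct vertices that induce the graph
described by [r].  A total function on numbers makes adding a vertex and
passing to a subsequence of the vertices instances of the same notion. *)
Definition realizes (G : sgraph) n (r : rel nat) (f : nat -> G) : Prop :=
  {in gtn n &, injective f} /\ {in gtn n &, forall i j, edge (f i) (f j) = r i j}.

Lemma realizes_succ (G : sgraph) n (r r' : rel nat) (f g : nat -> G) :
  realizes n r f -> {in gtn n, g =1 f} -> {in gtn n, forall i, f i != g n} ->
  {in gtn n &, r' =2 r} -> ~~ r' n n ->
  {in gtn n, forall i, r' n i = edge (g n) (f i) /\ r' i n = edge (g n) (f i)} ->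
  realizes n.+1 r' g.
Proof.
move=> [inj_f eq_f] eq_g new_g eq_r r'nn r'n.
have lt_or i : i \in gtn n.+1 -> i = n \/ i \in gtn n.
  by rewrite !inE ltnS leq_eqVlt => /predU1P[]; [left | right].
split=> i j /lt_or[->|ltin] /lt_or[->|ltjn] //.
- by rewrite (eq_g j) // => /esym/eqP; rewrite (negPf (new_g j _)).
- by rewrite (eq_g i) // => /eqP; rewrite (negPf (new_g i _)).
- by rewrite !eq_g //; apply: inj_f.
- by rewrite edge_irrefl (negPf r'nn).
- by rewrite (eq_g j) // (r'n j ltjn).1.
- by rewrite (eq_g i) // edge_sym (r'n i ltin).2.
by rewrite !eq_g // eq_r // eq_f.
Qed.

Definition extend (G : sgraph) n (f : nat -> G) z i := if i == n then z else f i.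

Definition attach n (m : seq nat) (r : rel nat) : rel nat := fun i j =>
  if i == n then j \in m else if j == n then i \in m else r i j.

Lemma realizes_attach (G : sgraph) n r (f : nat -> G) z m :
  realizes n r f -> {in gtn n, forall i, f i != z} ->
  m =i [pred i | (i < n) && edge z (f i)] ->
  realizes n.+1 (attach n m r) (extend n f z).
Proof.
move=> fP new_z mE; have neq i : i \in gtn n -> (i == n) = false.
  by rewrite inE => /ltn_eqF.
apply: (realizes_succ fP); rewrite /extend ?eqxx //.
- by move=> i /neq ->.
- by move=> i j /neq ni /neq nj; rewrite /attach ni nj.
- by rewrite /attach eqxx mE !inE ltnn.
move=> i ltin; rewrite /attach !eqxx (neq _ ltin) !mE !inE.
by rewrite inE in ltin; rewrite ltin.
Qed.

(** * A terminating search for a contradiction *)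

(** Unlike [has] and [all], whose connectives are functions of two booleans,
[some] and [every] stop at the first decisive element when arguments are
evaluated eagerly.  The search relies on this to skip
the branches behind a decided one. *)
Fixpoint some T (a : pred T) s :=
  if s is x :: s' then if a x then true else some a s' else false.

Fixpoint every T (a : pred T) s :=
  if s is x :: s' then if a x then every a s' else false else true.

Lemma someE T (a : pred T) s : some a s = has a s.
Proof. by elim: s => //= x s ->; case: (a x). Qed.

Lemma everyE T (a : pred T) s : every a s = all a s.
Proof. by elim: s => //= x s ->; case: (a x). Qed.

Arguments every : simpl never.

(** Backtracking search for an induced copy of [P] among the vertices below [n]
of [r]: [t] lists the images already chosen, in order, and [k] more are
needed. *)
Fixpoint copy_from (P : rel nat) n (r : rel nat) (k : nat) (t : seq nat) : bool :=
  if k is k'.+1 then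
    some (fun v =>
      if v \in t then false else
      if every (fun i => r v (nth 0 (rcons t v) i) == P (size t) i)
               (iota 0 (size t).+1)
      then copy_from P n r k' (rcons t v) else false)
      (iota 0 n)
  else true.

Lemma copy_fromP (G : sgraph) (P : rel nat) n r (f : nat -> G) k t :
  symmetric P -> realizes n r f -> all (gtn n) t ->
  realizes (size t) P (fun i => f (nth 0 t i)) ->
  copy_from P n r k t -> exists g : nat -> G, realizes (size t + k) P g.
Proof.
move=> Psym fP; elim: k t => [|k IH] t lt_t tP /=.
  by rewrite addn0; exists (fun i => f (nth 0 t i)).
rewrite someE => /hasP[v]; rewrite mem_iota add0n => /= ltvn.
case: ifP => // vt; case: ifP => //; rewrite everyE => /allP vP /IH.
have nth_old i : i < size t -> nth 0 (rcons t v) i = nth 0 t i.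
  by rewrite nth_rcons => ->.
have nth_new : nth 0 (rcons t v) (size t) = v by rewrite nth_rcons ltnn eqxx.
have lt_nth i : i < size t -> nth 0 t i \in gtn n.
  by move=> lti; apply: (allP lt_t); rewrite mem_nth.
have Pv i : i < (size t).+1 -> P (size t) i = r v (nth 0 (rcons t v) i).
  by move=> lti; apply/esym/eqP/vP; rewrite (mem_iota 0 (size t).+1).
rewrite size_rcons addSnnS; apply.
  by rewrite all_rcons lt_t inE ltvn.
apply: (realizes_succ tP).
- by move=> i lti; rewrite nth_old.
- move=> i lti; rewrite nth_new; apply/eqP => /fP.1 eqv.
  by move: vt; rewrite -eqv ?mem_nth // lt_nth.
- by [].
- by rewrite Pv // nth_new -fP.2 ?edge_irrefl.
move=> i lti; rewrite [P i _]Psym Pv; last exact: ltnW.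
by rewrite nth_old // nth_new -fP.2 // lt_nth.
Qed.

(** K_3, K_{2,3} and the 2 x 3 grid, as a number of vertices and a list of
edges. *)
Definition base_obstructions : seq (nat * seq (nat * nat)) :=
  [:: (3, [:: (0, 1); (1, 2); (0, 2)]);
      (5, [:: (0, 2); (0, 3); (0, 4); (1, 2); (1, 3); (1, 4)]);
      (6, [:: (0, 1); (1, 2); (3, 4); (4, 5); (0, 3); (1, 4); (2, 5)])].

(** P_7, C_7, F_1, ..., F_5, in the same format. *)
Definition critical_obstructions : seq (nat * seq (nat * nat)) :=
  [:: (7, [:: (0, 1); (1, 2); (2, 3); (3, 4); (4, 5); (5, 6)]);
      (7, [:: (0, 1); (1, 2); (2, 3); (3, 4); (4, 5); (5, 6); (6, 0)]);
      (6, [:: (0, 1); (1, 2); (0, 3); (1, 4); (2, 5)]);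
      (7, [:: (0, 1); (1, 2); (2, 3); (3, 0); (0, 4); (4, 5); (5, 6)]);
      (7, [:: (0, 1); (1, 2); (2, 3); (3, 0); (0, 4); (4, 5); (5, 6); (6, 1)]);
      (7, [:: (0, 1); (1, 2); (2, 3); (3, 0); (0, 4); (4, 5); (5, 6); (6, 0)]);
      (7, [:: (0, 1); (1, 2); (2, 3); (3, 0); (1, 4); (4, 5); (5, 3); (2, 6)])].

Definition obstructions := base_obstructions ++ critical_obstructions.

Definition obstructed n (r : rel nat) : bool :=
  some (fun kE => copy_from (adj kE.2) n r kE.1 [::]) obstructions.

(** All sets of numbers below [n], as candidates for the neighbours of a new
vertex among [n] named ones. *)
Fixpoint traces n : seq (seq nat) :=
  if n is n'.+1 then traces n' ++ map (cons n') (traces n') else [:: [::]].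

Lemma tracesP n (A : pred nat) :
  exists2 m, m \in traces n & m =i [pred i | (i < n) && A i].
Proof.
elim: n => [|n [m mn mE]]; first by exists [::].
exists (if A n then n :: m else m) => [|i].
  by rewrite /= mem_cat; case: (A n); rewrite ?mn // map_f ?orbT.
rewrite inE ltnS (leq_eqVlt i) andb_orl.
by case: ifP => An; rewrite ?inE mE ?inE; case: eqP => //= ->; rewrite An ?ltnn.
Qed.

(** One branching step: add a vertex whose neighbourhood satisfies [C] in all
possible ways, and let [next] deal with the results that contain no forbidden
graph. *)
Definition grow (C : pred (seq nat)) (next : nat -> rel nat -> bool) n r :=
  every (fun m =>
    if C m then
      if obstructed n.+1 (attach n m r) then true else next n.+1 (attach n m r)
    else true) (traces n).

(** Vertices 0 and 1 are the vertices x and y of the minimal counterexample.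
Any pair dominating the named vertices may be used to force a new vertex, so
success for one pair is enough; [k] bounds the number of forced vertices. *)
Fixpoint refute k n (r : rel nat) : bool :=
  if k is k'.+1 then
    some (fun pq =>
      if every (fun i => [|| pq.1 == i, r pq.1 i, pq.2 == i | r pq.2 i]) (iota 0 n)
      then grow (fun m => [&& pq.1 \notin m, pq.2 \notin m & (0 \in m) || (1 \in m)])
                (refute k') n r
      else false) [seq (p, q) | p <- iota 0 n, q <- iota 0 n]
  else false.

(** The vertices 0, 1, 2, 3 are x, y, v, w.  Unless x and y are adjacent or w
is a common neighbour, a path of length 2 or 3 from x to y has to be named
before the search starts: through a common neighbour, through w, or through
two new vertices. *)
Definition refute_linked n r : bool :=
  if r 0 1 || r 3 1 then refute 4 n r else
  [&& grow (fun m => (0 \in m) && (1 \in m)) (refute 4) n r,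
      grow (fun m => (1 \in m) && (3 \in m)) (refute 4) n r
    & grow (fun m => 0 \in m)
           (grow (fun m => (1 \in m) && (4 \in m)) (refute 4)) n r].

Definition refute_all : bool :=
  grow predT (grow predT
    (grow (fun m => (0 \notin m) && (1 \notin m))
      (grow (fun m => (0 \in m) && (2 \in m)) refute_linked)))
    0 (fun _ _ => false).

Lemma refute_all_true : refute_all.
Proof. by vm_compute. Qed.

(** * Soundness of the search *)

(** [near p] is the closed neighbourhood of [p]. *)
Definition near (G : sgraph) (p z : G) : bool := (p == z) || edge p z.

Definition obstruction_free (G : sgraph) : Prop :=
  {in obstructions, forall kE, forall f : nat -> G, ~ realizes kE.1 (adj kE.2) f}.

Section Soundness.
Variable G : sgraph.
Hypothesis Gfree : obstruction_free G.
Implicit Types (f : nat -> G) (x y z : G).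

Lemma unobstructed n r f : realizes n r f -> ~~ obstructed n r.
Proof.
move=> fP; apply/negP; rewrite /obstructed someE => /hasP[kE kEin].
have nilP : realizes 0 (adj kE.2) (fun i => f (nth 0 [::] i)) by split.
by case/(@copy_fromP _ _ _ _ _ _ [::] (adjC _) fP isT nilP) => g; apply: Gfree.
Qed.

(** An actual vertex [z] has some trace on the named vertices, so it selects one
of the branches of [grow]; the branch is not cut, as a forbidden graph found
there would live in [G]. *)
Lemma growP (C : pred (seq nat)) (next : nat -> rel nat -> bool) n r f z :
  realizes n r f -> {in gtn n, forall i, f i != z} ->
  (forall m, m =i [pred i | (i < n) && edge z (f i)] -> C m) ->
  grow C next n r ->
  exists2 r', next n.+1 r' & realizes n.+1 r' (extend n f z).
Proof.
move=> fP new_z CP; have [m mn mE] := tracesP n (fun i => edge z (f i)).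
rewrite /grow everyE => /allP/(_ m mn); rewrite CP //.
have gP := realizes_attach fP new_z mE.
by rewrite (negPf (unobstructed gP)); exists (attach n m r).
Qed.

(** The invariant of the search: the set [U] to be dominated consists of named
vertices and of neighbours of x and y, which carry the names 0 and 1. *)
Definition framed (U : {pred G}) n f : Prop := {in U, forall z,
  (exists2 i, i < n & f i = z) \/ edge z (f 0) || edge z (f 1)}.

Lemma framed_extend (U : {pred G}) n f z :
  framed U n f -> 1 < n -> framed U n.+1 (extend n f z).
Proof.
move=> covU lt1n u uU; rewrite /extend !ltn_eqF //; last exact: ltnW.
case: (covU u uU) => [[i ltin fiu]|]; [left | by right].
by exists i; [apply: ltnW | rewrite ltn_eqF].
Qed.

(** The pair chosen by the search leaves some [z] of [U] undominated, whereas it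
dominates the named vertices.  Hence [z] is not named, and by the invariant it
is adjacent to x or y, so that the search has considered it. *)
Lemma refuteP (U : {pred G}) k n r f :
  (forall p q, exists2 z, z \in U & ~~ (near p z || near q z)) ->
  framed U n f -> 1 < n -> realizes n r f -> ~ refute k n r.
Proof.
move=> noU; elim: k n r f => //= k IH n r f covU lt1n fP.
rewrite someE => /hasP[_ /allpairsP[[p q] /=[+ + ->]]] /=.
rewrite !mem_iota !add0n => ltpn ltqn; case: ifP => // + growT.
rewrite everyE => /allP domf.
have [z zU] := noU (f p) (f q).
rewrite !negb_or => /andP[/andP[pz epz] /andP[qz eqz]].
have new_z : {in gtn n, forall i, f i != z}.
  move=> i ltin; apply/eqP => fiz; have := domf i.
  rewrite mem_iota -!fP.2 // fiz (negPf epz) (negPf eqz) !orbF => /(_ ltin).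
  by case/orP => /eqP eqi; move: pz qz; rewrite -fiz eqi eqxx ?andbF.
case: (growP fP new_z _ growT) => [m mE|r' refT gP].
  rewrite !mE !inE ![edge z _]edge_sym (negPf epz) (negPf eqz) !andbF /=.
  rewrite lt1n (ltnW lt1n) /= ![edge _ z]edge_sym.
  case: (covU z zU) => // -[i ltin fiz].
  by have := new_z i ltin; rewrite fiz eqxx.
exact: (IH _ _ _ (framed_extend z covU lt1n) (leqW lt1n) gP refT).
Qed.

Arguments refute : simpl never.

(** Here [U] is the connected set T + v, and the last hypothesis says that the
distance of x and y is at most 3, which is what the connectedness of T gives.
The proof names the vertices one after the other in the order prescribed by
[refute_all]. *)
Lemma no_minimal_counterexample (U : {pred G}) x y v w :
  (forall p q, exists2 z, z \in U & ~~ (near p z || near q z)) ->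
  {in U, forall z, [|| z == v, near x z | near y z]} ->
  ~~ near x v -> ~~ near y v -> x != y -> edge w x -> edge w v ->
  [\/ edge x y, exists2 u, edge u x & edge u y
    | exists a b, [/\ edge a x, edge b y & edge b a]] -> False.
Proof.
move=> noU covU; rewrite /near !negb_or => /andP[xv exv] /andP[yv eyv] xy wx wv.
have edge_neq a b : edge a b -> a != b.
  by apply: contraTneq => ->; rewrite edge_irrefl.
have evx : edge v x = false by rewrite edge_sym (negPf exv).
have evy : edge v y = false by rewrite edge_sym (negPf eyv).
have f0P : realizes 0 (fun _ _ => false) (fun _ => x) by split.
have := refute_all_true; rewrite /refute_all.
case/(growP (z := x) f0P) => // r1 + f1P.
case/(growP (z := y) f1P) => [[]//|//|r2 + f2P].
case/(growP (z := v) f2P) => [[|[]]//|m mE|r3 + f3P].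
  by rewrite !mE !inE /= evx evy.
case/(growP (z := w) f3P) => [[|[|[|//]]] _|m mE|r4 + f4P].
- by rewrite eq_sym edge_neq.
- by rewrite /extend /=; apply: contraNneq eyv => ->.
- by rewrite eq_sym edge_neq.
- by rewrite !mE !inE /= wx wv.
set f4 := extend 3 _ w in f4P.
have cov4 : framed U 4 f4.
  move=> z /covU /or3P[/eqP->|/orP[/eqP<-|exz]|/orP[/eqP<-|eyz]].
  - by left; exists 2.
  - by left; exists 0.
  - by right; rewrite edge_sym exz.
  - by left; exists 1.
  - by right; rewrite orbC edge_sym eyz.
rewrite /refute_linked -!f4P.2 // -[f4 0]/x -[f4 1]/y -[f4 3]/w.
case: ifP => [_ /(refuteP noU cov4 isT f4P)//|/norP[exy ewy]].
case/and3P => commonT pathwT pathT.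
have new4 u : edge u y -> {in gtn 4, forall i, f4 i != u}.
  move=> uy [|[|[|[|//]]]] _; rewrite /f4 /extend /=.
  - by apply: contraNneq exy => ->.
  - by rewrite eq_sym edge_neq.
  - by apply: contraFneq evy => ->.
  - by apply: contraNneq ewy => ->.
case=> [exy'|[u ux uy]|[a [b [ax yb ba]]]]; first by rewrite exy' in exy.
  case: (growP f4P (new4 u uy) _ commonT) => [m mE|r5 ref5 f5P].
    by rewrite !mE !inE /= ux uy.
  exact: (refuteP noU (framed_extend _ cov4 isT) isT f5P ref5).
(* The path x a b y may pass through w, which has a name already. *)
have [eaw | naw] := eqVneq a w.
  case: (growP f4P (new4 b yb) _ pathwT) => [m mE|r5 ref5 f5P].
    by rewrite !mE !inE /= -[f4 3]/w -eaw ba yb.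
  exact: (refuteP noU (framed_extend _ cov4 isT) isT f5P ref5).
have new_a : {in gtn 4, forall i, f4 i != a}.
  move=> [|[|[|[|//]]]] _; rewrite /f4 /extend /=.
  - by rewrite eq_sym edge_neq.
  - by apply: contraNneq exy => ->; rewrite edge_sym.
  - by apply: contraFneq evx => ->.
  - by rewrite eq_sym.
case: (growP f4P new_a _ pathT) => [m mE|r5 grow5 f5P].
  by rewrite !mE !inE /= ax.
have new_b : {in gtn 5, forall i, extend 4 f4 a i != b}.
  move=> i lti5; have [i4|ni4] := eqVneq i 4.
    by rewrite i4 /= eq_sym edge_neq.
  rewrite /extend (negPf ni4); apply: new4 => //.
  by rewrite inE ltn_neqAle ni4 -ltnS.
case: (growP f5P new_b _ grow5) => [m mE|r6 ref6 f6P].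
  by rewrite !mE !inE /= yb ba.
exact: (refuteP noU (framed_extend _ (framed_extend _ cov4 isT) isT) isT f6P ref6).
Qed.

(** * Connected sets have dominating pairs *)

(** Connectedness of a finite set, witnessed by an order in which each vertex
is attached to those that were added before it. *)
Fixpoint grown (s : seq G) : bool :=
  if s is v :: s' then ((s' == [::]) || has (edge v) s') && grown s' else true.

(** A connected set covered by two proper parts has a vertex in both parts or an
edge between them.  For closed neighbourhoods this bounds the distance of the
centres by 3. *)
Lemma grown_link (A B : pred G) s :
  grown s -> {in s, forall z, A z || B z} ->
  ~~ all A s -> ~~ all B s -> exists a b, [/\ A a, B b & (a == b) || edge b a].
Proof.
elim: s => //= v s IH /andP[vs gs] AB nA nB.
have ABs : {in s, forall z, A z || B z} by move=> z zs; rewrite AB // inE zs orbT.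
have ABv := AB v (mem_head _ _).
have [As | nAs] := boolP (all A s); last have [Bs | nBs] := boolP (all B s).
- move: nA ABv; rewrite /= As andbT => /negPf-> /= Bv.
  case/orP: vs => [/eqP s0|/hasP[w ws evw]]; first by rewrite /= Bv s0 in nB.
  by exists w, v; rewrite (allP As) // Bv evw orbT.
- move: nB ABv; rewrite /= Bs andbT => /negPf->; rewrite orbF => Av.
  case/orP: vs => [/eqP s0|/hasP[w ws evw]]; first by rewrite /= Av s0 in nA.
  by exists v, w; rewrite (allP Bs) // Av edge_sym evw orbT.
exact: IH.
Qed.

(** Otherwise take the first stage without a dominating pair: it is the minimal
counterexample that the search has excluded. *)
Lemma grown_dominating_pair (r : G) s :
  grown s -> exists p q, {in s, forall z, near p z || near q z}.
Proof.
elim: s => [|v s IH] /=; first by exists r, r.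
case/andP=> vs gs; have [x [y xyP]] := IH gs.
have [/existsP[p /existsP[q /allP pqP]] | nodom] :=
  boolP [exists p, exists q, all (fun z => near p z || near q z) (v :: s)].
  by exists p, q.
have noU p q : exists2 z, z \in v :: s & ~~ (near p z || near q z).
  apply/hasP; rewrite -[has _ _]negbK -all_predC; apply: contra nodom => pqP.
  apply/existsP; exists p; apply/existsP; exists q; apply: sub_all pqP => z.
  by rewrite /= negbK.
(* If [near p] contained all of [s], then [p] and [v] would be a pair. *)
have nbhd p : ~~ all (near p) s.
  apply/negP => /allP pP; have [z] := noU p v.
  by rewrite inE => /predU1P[->|/pP ->//]; rewrite /near eqxx orbT.
have [xv | nxv] := boolP (near x v).
  by exists x, y => z; rewrite inE => /predU1P[->|/xyP//]; rewrite xv.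
have [yv | nyv] := boolP (near y v).
  by exists x, y => z; rewrite inE => /predU1P[->|/xyP//]; rewrite yv orbT.
move: vs; have /negPf-> /= : s != [::] by apply: contraNneq (nbhd v) => ->.
case/hasP=> w ws evw; exfalso.
wlog xw : x y xyP nxv nyv / near x w.
  move=> wl; have /orP[xw|yw] := xyP w ws; first exact: (wl x y).
  by apply: (wl y x) => // z zs; rewrite orbC xyP.
have nxy : x != y.
  by apply: contraNneq (nbhd x) => exy; apply/allP => z /xyP; rewrite -exy orbb.
apply: (@no_minimal_counterexample (mem (v :: s)) x y v w) => //.
- by move=> z; rewrite inE => /predU1P[->|/xyP->]; rewrite ?eqxx ?orbT.
- case/orP: xw => [/eqP exw|]; last by rewrite edge_sym.
  by move: nxv; rewrite /near exw edge_sym evw orbT.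
- by rewrite edge_sym.
have [a [b [xa yb ab]]] := grown_link gs xyP (nbhd x) (nbhd y).
case/orP: xa => [/eqP xa|xa]; case/orP: yb => [/eqP yb|yb];
  case/orP: ab => [/eqP ab|ba].
- by rewrite xa yb ab eqxx in nxy.
- by apply: Or31; rewrite xa yb edge_sym.
- by apply: Or31; rewrite xa ab edge_sym.
- by apply: Or32; exists b; rewrite ?xa // edge_sym.
- by apply: Or31; rewrite yb -ab.
- by apply: Or32; exists a; rewrite edge_sym // yb.
- by apply: Or32; exists a; rewrite edge_sym // ab.
by apply: Or33; exists a, b; split; rewrite // edge_sym.
Qed.

Lemma grown_path u p s : u \in s -> grown s -> path edge u p -> grown (rev p ++ s).
Proof.
elim: p u s => [|a p IH] u s //= us gs /andP[eua pathp].
rewrite rev_cons cat_rcons; apply: (IH a) => //; first exact: mem_head.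
rewrite /= gs andbT; apply/orP; right; apply/hasP.
by exists u; rewrite // edge_sym.
Qed.

Lemma component_dominating_pair (r : G) :
  exists p q, forall z, connect edge r z -> near p z || near q z.
Proof.
suff [s gs rs] : exists2 s, grown s
    & {in enum G, forall z, connect edge r z -> z \in s}.
  by have [p [q pq]] := grown_dominating_pair r gs; exists p, q => z /rs zs;
    apply/pq/zs; rewrite mem_enum.
suff [s [gs _ rs]] : exists s, [/\ grown s, r \in s
    & {in enum G, forall z, connect edge r z -> z \in s}] by exists s.
elim: (enum G) => [|z l [s [gs rs ls]]]; first by exists [:: r]; rewrite mem_head.
have [/connectP[p pathp ->] | nrz] := boolP (connect edge r z); last first.
  exists s; split=> // u; rewrite inE => /predU1P[-> /idPn//|/ls//].
exists (rev p ++ s); split; first exact: (grown_path rs).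
  by rewrite mem_cat rs orbT.
move=> u; rewrite inE mem_cat mem_rev => /predU1P[-> _|/ls us /us ->]; last first.
  by rewrite orbT.
by have := mem_last r p; rewrite inE => /predU1P[->|->//]; rewrite rs orbT.
Qed.

End Soundness.

(** * Exponential domination against domination *)

Section Weights.
Import Order.TTheory GRing.Theory Num.Theory.
Variable H : sgraph.
Implicit Types (D : {set H}) (u v : H).
Local Open Scope ring_scope.

Lemma half_pow0 : half_pow (Some 0) = 2%:R.
Proof. by rewrite /half_pow sub0r exprN1 invrK. Qed.

Lemma half_powS k : half_pow (Some k.+1) = 2^-1 ^+ k.
Proof. by rewrite /half_pow intS addrAC subrr add0r. Qed.

Lemma half_ge0 : 0 <= 2^-1 :> rat.
Proof. by rewrite invr_ge0 ler0n. Qed.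

Lemma half_lt1 : 2^-1 < 1 :> rat.
Proof. by rewrite invf_lt1 ?ltr0n ?ltr1n. Qed.

Lemma half_pow_ge0 d : 0 <= half_pow d.
Proof. by case: d => [k|]; rewrite ?lexx // exprz_ge0 // half_ge0. Qed.

Lemma half_pow_dist D u v p :
  admissible_path D u v p -> 2^-1 ^+ (size p).-1 <= half_pow (dist D u v).
Proof.
move=> pP; move: (distP D u v); case: dist => [[|k] [_ /(_ p pP) lekp]|/(_ p)].
- rewrite half_pow0; apply: (@le_trans _ _ 1); last by rewrite ler1n.
  by rewrite exprn_ile1 ?half_ge0 // ltW ?half_lt1.
- rewrite half_powS; apply: ler_wiXn2l.
  + exact: half_ge0.
  + exact: ltW half_lt1.
  + by case: (size p) lekp.
by rewrite pP.
Qed.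

Lemma half_pow_weight D u v : v \in D -> half_pow (dist D u v) <= weight D u.
Proof.
move=> vD; rewrite /weight (bigD1 v) //= lerDl.
by apply: sumr_ge0 => w _; apply: half_pow_ge0.
Qed.

Lemma admissible_edge D u v : u \notin D -> v \in D -> edge u v ->
  admissible_path D u v [:: v].
Proof.
move=> uD vD euv; rewrite /admissible_path /= euv eqxx inE /= andbT.
apply/andP; split; first by apply: contraTneq euv => ->; rewrite edge_irrefl.
rewrite (_ : _ :&: D = [set v]) ?cards1 //; apply/setP => w; rewrite !inE.
by case: eqP => [->|_]; case: eqP => [->|_]; rewrite ?(negPf uD) ?vD.
Qed.

Lemma weight_edge D u v : v \in D -> edge u v -> 1 <= weight D u.
Proof.
move=> vD euv; have [uD | uD] := boolP (u \in D); first by rewrite weight_in.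
apply: le_trans (half_pow_weight u vD).
exact: (half_pow_dist (admissible_edge uD vD euv)).
Qed.

Lemma dist_connected D u v k : dist D u v = Some k -> connect edge u v.
Proof.
move=> duv; move: (distP D u v); rewrite duv => -[/linkedP[p pP _] _].
by case/and5P: pP => pathp /eqP lastp _ _ _; apply/connectP; exists p.
Qed.

Lemma weight_connected D u :
  1 <= weight D u -> exists2 d, d \in D & connect edge u d.
Proof.
move=> wu; apply/exists_inP; apply: contraLR wu => /exists_inPn nou.
rewrite -ltNge /weight big1 // => v vD.
case duv: (dist D u v) => [k|//]; case/negP: (nou v vD).
exact: dist_connected duv.
Qed.

(** Only [d] contributes to the weight of [u], so its contribution is at least
1, which means distance at most 1. *)
Lemma weight_lone D u d : d \in D -> {in D, forall v, connect edge u v -> v = d} ->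
  1 <= weight D u -> near d u.
Proof.
move=> dD lone; rewrite /weight (bigD1 d) //= big1 ?addr0 => [|v /andP[vD vd]].
  move: (distP D u d); case: dist => [[|k] [/linkedP[p + szp] _]|_].
  - by rewrite (size0nil szp) => /and5P[_ /= /eqP-> _ _ _] _; rewrite /near eqxx.
  - rewrite half_powS; case: k szp => [|k] szp pP; last first.
      by rewrite leNgt exprn_ilt1 ?half_ge0 ?half_lt1.
    case: p szp pP => [|a []] //= _ /and5P[] /=.
    by rewrite andbT => eua /eqP <- _ _ _ _; rewrite /near edge_sym eua orbT.
  - by rewrite ler10.
case duv: (dist D u v) => [k|//]; case/eqP: vd; apply: lone => //.
exact: dist_connected duv.
Qed.

(** A path of length 2 contributes 1/2, so two different ends in [D] suffice.
This is the way in which exponential domination is cheaper in the seven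
critical graphs. *)
Lemma weight_two_paths D u p q v w :
  u \notin D -> p \in D -> q \in D -> p != q -> v \notin D -> w \notin D ->
  edge u v -> edge v p -> edge u w -> edge w q -> 1 <= weight D u.
Proof.
have half a b : u \notin D -> b \in D -> a \notin D -> edge u a -> edge a b ->
    2^-1 <= half_pow (dist D u b).
  move=> uD bD aD eua eab.
  have nub : u != b by apply: contraNneq uD => ->.
  have nua : u != a by apply: contraTneq eua => ->; rewrite edge_irrefl.
  have nab : a != b by apply: contraNneq aD => ->.
  apply: (@half_pow_dist D u b [:: a; b]).
  rewrite /admissible_path /= eua eab eqxx !inE negb_or nua nub nab aD /= andbT.
  rewrite (_ : _ :&: D = [set b]) ?cards1 //; apply/setP => c; rewrite !inE.
  by case: eqP => [->|_]; case: eqP => [->|_]; rewrite ?(negPf uD) ?bD.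
move=> uD pD qD npq vD wD euv evp euw ewq.
rewrite /weight (bigD1 p) //= (bigD1 q) /=; last by rewrite qD eq_sym.
rewrite addrA [leLHS]splitr mul1r.
apply: ler_wpDr; first by apply: sumr_ge0 => c _; apply: half_pow_ge0.
by apply: lerD; [apply: (half v) | apply: (half w)].
Qed.

End Weights.

Lemma dominating_exp_dominating (H : sgraph) (D : {set H}) :
  dominating D -> exp_dominating D.
Proof.
move=> /forallP domD; apply/forallP => u.
have [uD|uD] := boolP (u \in D); first by rewrite weight_in.
have /implyP/(_ uD)/exists_inP[v vD euv] := domD u.
exact: weight_edge vD euv.
Qed.

(** The new set is the image of [D] under a map that acts inside each component:
a vertex that is alone in its component stays, and otherwise one chosen vertex
of the component, its leader, is sent to the first element of the dominating
pair, and all others are sent to the second. *)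
Lemma exp_dominating_replace (H : sgraph) (D : {set H}) :
  (forall r : H, exists p q, forall z, connect edge r z -> near p z || near q z) ->
  exp_dominating D -> exists2 D' : {set H}, dominating D' & #|D'| <= #|D|.
Proof.
case/fin_all_exists => P /fin_all_exists[Q PQ] /forallP expD.
have csym : connect_sym (@edge H) by apply: sym_connect_sym; apply: edge_sym.
pose lone d := [forall (c | c \in D), (root edge c == root edge d) ==> (c == d)].
pose leader r := [pick c | (c \in D) && (root edge c == r)].
pose g d := if lone d then d else
  if leader (root edge d) == Some d then P (root edge d) else Q (root edge d).
exists (g @: D); last exact: leq_imset_card.
suff domg z : exists2 d, d \in g @: D & near d z.
  apply/forallP => z; apply/implyP => zD; have [d dD] := domg z.
  case/orP=> [/eqP dz|edz]; first by rewrite -dz dD in zD.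
  by apply/exists_inP; exists d; rewrite // edge_sym.
have [d dD zd] := weight_connected (expD z).
have rootz : root edge z = root edge d by apply/rootP.
have [ld | nld] := boolP (lone d).
  exists d; first by apply/imsetP; exists d; rewrite /g ?ld.
  apply: weight_lone (expD z) => // c cD zc; apply/eqP.
  have /forall_inP/(_ c cD)/implyP := ld; apply.
  by rewrite -rootz eq_sym; apply/eqP/rootP.
have [c cD /andP[/eqP rc ncd]] : exists2 c, c \in D
    & (root edge c == root edge d) && (c != d).
  by move: nld => /forall_inPn[c cD]; rewrite negb_imply; exists c.
have nlone a b : b \in D -> root edge b = root edge a -> b != a -> ~~ lone a.
  move=> bD rb nba; apply/forall_inPn; exists b => //.
  by rewrite rb eqxx.
have [l /andP[lD /eqP rl] leadE] : exists2 l, (l \in D) && (root edge l == root edge d)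
    & leader (root edge d) = Some l.
  rewrite /leader; case: pickP => [l lP|/(_ d)]; first by exists l.
  by rewrite dD eqxx.
have [m mD /andP[/eqP rm nml]] : exists2 m, m \in D
    & (root edge m == root edge d) && (m != l).
  by have [ecl|ncl] := eqVneq c l; [exists d | exists c];
    rewrite // ?rc ?eqxx // -ecl eq_sym.
have gl : g l = P (root edge d).
  by rewrite /g (negPf (nlone l m mD _ nml)) ?rm ?rl // leadE eqxx.
have gm : g m = Q (root edge d).
  rewrite /g (negPf (nlone m l lD _ _)) ?rm ?rl //; last by rewrite eq_sym.
  by rewrite leadE; case: eqP => // -[elm]; rewrite elm eqxx in nml.
have /PQ/orP[Pz|Qz] : connect edge (root edge d) z.
  by rewrite -rootz csym connect_root.
- by exists (P (root edge d)); rewrite // -gl imset_f.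
- by exists (Q (root edge d)); rewrite // -gm imset_f.
Qed.

Lemma gamma_eq_gamma_e (H : sgraph) :
  obstruction_free H -> gamma H = gamma_e H.
Proof.
move=> Hfree; apply/eqP; rewrite eqn_leq; apply/andP; split.
  have [[D expD <-] _] := gamma_eP H.
  have [D' domD'] := exp_dominating_replace (component_dominating_pair Hfree) expD.
  by apply: leq_trans; apply: (gammaP H).2.
have [[D domD <-] _] := gammaP H.
by apply: (gamma_eP H).2; apply: dominating_exp_dominating.
Qed.

(** * Presentations of the forbidden graphs *)

(** [c] numbers the vertices of [F] from 0 to [n - 1] in such a way that [E]
lists the edges; this transfers computations on edge lists to [F] and to the
graphs isomorphic to it. *)
Definition presents (F : sgraph) n E (c : F -> nat) : Prop :=
  [/\ injective c, forall x, c x < n, forall i, i < n -> exists x, c x = i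
    & forall x y, edge x y = adj E (c x) (c y)].

Definition presented (F : sgraph) (kE : nat * seq (nat * nat)) : Prop :=
  exists c, @presents F kE.1 kE.2 c.

Lemma presented_isomorphic F H kE :
  isomorphic H F -> presented F kE -> presented H kE.
Proof.
move=> [f [[g fK gK] fE]] [c [inj_c lt_c onto_c cE]]; exists (c \o f); split.
- by apply: inj_comp => //; apply: can_inj fK.
- by move=> x; apply: lt_c.
- by move=> i /onto_c[x <-]; exists (g x); rewrite /= gK.
by move=> x y; rewrite -fE cE.
Qed.

Lemma realizes_induced (G F : sgraph) kE (f : nat -> G) :
  presented F kE -> realizes kE.1 (adj kE.2) f ->
  exists S : {set G}, isomorphic (induced S) F.
Proof.
move=> [c [inj_c lt_c _ cE]] [inj_f fE]; exists [set f (c x) | x : F].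
have inS x : f (c x) \in [set f (c x) | x : F] by apply/imsetP; exists x.
pose g x : induced [set f (c x) | x : F] := exist _ (f (c x)) (inS x).
have inj_fc : injective (f \o c).
  by move=> x y /(inj_f _ _ (lt_c x) (lt_c y))/inj_c.
have inj_g : injective g by move=> x y [/inj_fc].
have [|h gK hK] := inj_card_bij inj_g.
  by rewrite card_sig (card_imset _ inj_fc).
exists h; split; first by exists g.
move=> x y; have -> : edge x y = edge (f (c (h x))) (f (c (h y))).
  by rewrite -{1}[x]hK -{1}[y]hK.
by rewrite fE ?cE ?inE ?lt_c.
Qed.

Lemma free_realizes Fs kEs (G : sgraph) :
  List.Forall2 presented Fs kEs -> free Fs G ->
  {in kEs, forall kE (f : nat -> G), ~ realizes kE.1 (adj kE.2) f}.
Proof.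
elim=> // F kE {}Fs {}kEs FkE _ IH freeG kE'; rewrite inE => /predU1P[->|kEin] f fP.
  have [S isoS] := realizes_induced FkE fP.
  by apply: (freeG F _ S isoS); left.
by apply: IH kEin f fP => F' F'in; apply: freeG; right.
Qed.

Lemma ord_presented n (r : rel 'I_n) rsym rirr E :
  (forall i j, r i j = adj E i j) -> presented (@SGraph _ r rsym rirr) (n, E).
Proof.
move=> rE; exists (fun x : 'I_n => x : nat); split=> //; first exact: val_inj.
by move=> i lti; exists (Ordinal lti).
Qed.

Lemma edge_list_presented n E :
  all (fun e => e.1 != e.2) E -> presented (edge_list_graph n E) (n, E).
Proof.
move=> /allP loopless; apply: ord_presented => i j.
rewrite /edge_list_rel -/(adj E i j); have [<-|//] := eqVneq.
by apply/esym/norP; split; apply/negP => /loopless /=; rewrite eqxx.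
Qed.

Lemma base_presented :
  List.Forall2 presented
    [:: complete_graph 3; complete_bipartite 2 3;
        cartesian (path_graph 2) (path_graph 3)] base_obstructions.
Proof.
repeat constructor.
- by apply: ord_presented => -[[|[|[|//]]] ?] [[|[|[|//]]] ?].
- exists (fun x : 'I_2 + 'I_3 => match x with inl i => i : nat | inr j => 2 + j end).
  split.
  - by move=> [[[|[|//]] ?]|[[|[|[|//]]] ?]] [[[|[|//]] ?]|[[|[|[|//]]] ?]] //= _;
      congr (_ _); apply: val_inj.
  - by move=> [[[|[|//]] ?]|[[|[|[|//]]] ?]].
  - move=> [|[|[|[|[|//]]]]] _.
    + by exists (inl ord0). + by exists (inl ord_max).
    + by exists (inr ord0). + by exists (inr (inord 1)); rewrite /= inordK.
    + by exists (inr ord_max).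
  - by move=> [[[|[|//]] ?]|[[|[|[|//]]] ?]] [[[|[|//]] ?]|[[|[|[|//]]] ?]].
- exists (fun x : 'I_2 * 'I_3 => 3 * x.1 + x.2).
  split.
  - by move=> [[[|[|//]] ?] [[|[|[|//]]] ?]] [[[|[|//]] ?] [[|[|[|//]]] ?]] //= _;
      congr (_, _); apply: val_inj.
  - by move=> [[[|[|//]] ?] [[|[|[|//]]] ?]].
  - move=> i lti.
    have lt2 : i %/ 3 < 2 by rewrite ltn_divLR.
    exists (Ordinal lt2, Ordinal (ltn_pmod i (isT : 0 < 3))).
    by rewrite /= mulnC -divn_eq.
  - by move=> [[[|[|//]] ?] [[|[|[|//]]] ?]] [[[|[|//]] ?] [[|[|[|//]]] ?]].
Qed.

Lemma critical_presented :
  List.Forall2 presented [:: path_graph 7; cycle_graph 7; F1; F2; F3; F4; F5]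
    critical_obstructions.
Proof.
repeat constructor; try exact: edge_list_presented.
  by apply: ord_presented => -[[|[|[|[|[|[|[|//]]]]]]] ?]
    [[|[|[|[|[|[|[|//]]]]]]] ?].
by apply: ord_presented => -[[|[|[|[|[|[|[|//]]]]]]] ?]
  [[|[|[|[|[|[|[|//]]]]]]] ?].
Qed.

(** * The forbidden graphs are counterexamples *)

Definition undominated (kE : nat * seq (nat * nat)) p q z :=
  [&& z != p, z != q, ~~ adj kE.2 z p & ~~ adj kE.2 z q].

Definition no_dominating_pair kE : bool :=
  all (fun p => all (fun q => has (undominated kE p q) (iota 0 kE.1)) (iota 0 kE.1))
      (iota 0 kE.1).

(** A condition sufficient for exponential domination that only looks at
distances up to 2: an undominated vertex must have a path of length 2 to both
[p] and [q]. *)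
Definition exp_dominating_pair (kE : nat * seq (nat * nat)) p q : bool :=
  (p != q) && all (fun z => undominated kE p q z ==>
    all (fun d => has (fun w => [&& w != p, w != q, adj kE.2 z w & adj kE.2 w d])
                      (iota 0 kE.1)) [:: p; q]) (iota 0 kE.1).

Lemma gamma_gt2 (H : sgraph) kE :
  0 < kE.1 -> presented H kE -> no_dominating_pair kE -> 2 < gamma H.
Proof.
case: kE => n E /= n_gt0 [c [/= inj_c lt_c onto_c cE]] /allP nopair.
have [x0 _] := onto_c 0 n_gt0.
have [[D /forallP domD <-] _] := gammaP H; rewrite ltnNge; apply/negP => leD2.
(* The pair may be degenerate: [p = q] is allowed in [no_dominating_pair]. *)
have [p [q Dpq]] : exists p q, D \subset [set p; q].
  move: leD2; rewrite leq_eqVlt ltnS leq_eqVlt ltnS leqn0.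
  case/or3P=> [/cards2P[p [q [_ ->]]]|/cards1P[p ->]|].
  - by exists p, q.
  - by exists p, p; rewrite setUid.
  - by rewrite cards_eq0 => /eqP->; exists x0, x0; rewrite sub0set.
have in_iota x : c x \in iota 0 n by rewrite mem_iota lt_c.
have /allP/(_ (c q) (in_iota q))/hasP[i] := nopair _ (in_iota p).
rewrite mem_iota add0n => /= lti; have [z <-] := onto_c i lti.
rewrite /undominated /= -!cE !(inj_eq inj_c) => /and4P[zp zq nzp nzq].
have := domD z; have /negPf-> : z \notin D.
  by apply: contraNN zp => /(subsetP Dpq); rewrite !inE (negPf zq) orbF.
case/exists_inP=> y /(subsetP Dpq); rewrite !inE => /orP[]/eqP->; exact/negP.
Qed.

Lemma gamma_e_le2 (H : sgraph) kE p q :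
  presented H kE -> p < kE.1 -> q < kE.1 -> exp_dominating_pair kE p q ->
  gamma_e H <= 2.
Proof.
case: kE => n E [c [/= inj_c lt_c onto_c cE]] /onto_c[a <-] /onto_c[b <-].
case/andP; rewrite (inj_eq inj_c) => nab /allP /= halfP.
have <- : #|[set a; b]| = 2 by rewrite cards2 nab.
apply: (gamma_eP H).2; apply/forallP => z.
have aD : a \in [set a; b] by rewrite !inE eqxx.
have bD : b \in [set a; b] by rewrite !inE eqxx orbT.
have := halfP (c z); rewrite mem_iota lt_c => /(_ isT).
rewrite /undominated /= -!cE !(inj_eq inj_c).
have [->|za] := eqVneq z a; first by rewrite weight_in.
have [->|zb] := eqVneq z b; first by rewrite weight_in.
have [eza _|nza] := boolP (edge z a); first exact: weight_edge aD eza.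
have [ezb _|nzb] := boolP (edge z b); first exact: weight_edge bD ezb.
rewrite andbT => /andP[/hasP[i + iP] /hasP[j + jP]].
rewrite !mem_iota !add0n => /onto_c[v cv] /onto_c[w cw].
move: iP jP; rewrite -cv -cw -!cE !(inj_eq inj_c).
move=> /and4P[va vb ezv eva] /and4P[wa wb ezw ewb].
by apply: (weight_two_paths _ aD bD nab _ _ ezv eva ezw ewb);
  rewrite !inE negb_or ?za ?va ?wa.
Qed.

(** For instance, the second and the sixth vertex of P_7 exponentially dominate
it, the middle vertex having distance 2 to both. *)
Lemma critical_pairs :
  {in critical_obstructions, forall kE, [/\ 0 < kE.1, no_dominating_pair kE
    & exists p q, [/\ p < kE.1, q < kE.1 & exp_dominating_pair kE p q]]}.
Proof.
have search : all (fun kE : nat * seq (nat * nat) => [&& 0 < kE.1, no_dominating_pair kE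
    & has (fun p => has (exp_dominating_pair kE p) (iota 0 kE.1)) (iota 0 kE.1)])
    critical_obstructions by vm_compute.
move=> kE /(allP search)/and3P[-> ->] /hasP[p + /hasP[q]].
by rewrite !mem_iota !add0n => ltp ltq pq; split=> //; exists p, q.
Qed.

Theorem corollary2 (G : sgraph) :
  free [:: complete_graph 3; complete_bipartite 2 3;
           cartesian (path_graph 2) (path_graph 3)] G ->
  ((forall S : {set G}, gamma (induced S) = gamma_e (induced S)) <->
   free [:: path_graph 7; cycle_graph 7; F1; F2; F3; F4; F5] G).
Proof.
move=> free_base; split=> [eq_gamma F Fin S isoS | free_critical S].
  have [kE kEin FkE] : exists2 kE, kE \in critical_obstructions & presented F kE.
    elim: critical_presented Fin => // F' kE Fs kEs FkE _ IH [<-|/IH[kE' kE'in FkE']].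
      by exists kE; rewrite ?mem_head.
    by exists kE'; rewrite // inE kE'in orbT.
  have HkE := presented_isomorphic isoS FkE.
  have [n_gt0 nopair [p [q [ltp ltq pq]]]] := critical_pairs kEin.
  have := gamma_gt2 n_gt0 HkE nopair.
  by rewrite eq_gamma ltnNge (gamma_e_le2 HkE ltp ltq pq).
apply: gamma_eq_gamma_e => kE + f [inj_f fE].
have fP : realizes kE.1 (adj kE.2) (val \o f).
  by split=> [i j iin jin /val_inj/inj_f->|i j iin jin] //; apply: fE.
rewrite mem_cat => /orP[kEin|kEin].
  exact: free_realizes base_presented free_base kE kEin _ fP.
exact: free_realizes critical_presented free_critical kE kEin _ fP.
Qed.
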